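(* Let $U,V$ be a solution of the variational equations for the canonical system of the Euler equations, defined on a domain $\mathfrak N$ of the space $t$, and suppose that the matrix $V$ is defined and invertible in $\mathfrak N$. Then the connection $\nabla$ generated by the field of extremals, with connection form $\zeta^\alpha=dx^\alpha-\mathfrak Y^\alpha_{i\beta}x^\beta dt^i$, is flat.
   Context: $\xi$ is a vector bundle with base coordinates $t=(t^1,\dots,t^n)$ and fiber coordinates $x=(x^1,\dots,x^\nu)$; Latin indices run over $1,\dots,n$, Greek over $1,\dots,\nu$; repeated indices are summed; $1\le k\le n$; $B^t$ is the transpose of $B$. Hamiltonian. For the functional $\int f(t,x,\frac{Dx}{Dt})\,dt^1\cdots dt^n$ put $q^\alpha_i=\partial x^\alpha/\partial t^i$, $p^i_\alpha=\partial f/\partial q^\alpha_i$, and let $\hat f$ be the value of $f$ on the slope field of the extremals. Define $$\tilde\Delta=\frac1{\binom nk\hat f^{\,k-1}}\operatorname{tr}\Lambda^k\left\|\hat f\delta^i_j+\tfrac nk p^i_\alpha q^\alpha_j\right\|$$ ($\Lambda^kR$ is the matrix of minors of order $k$ of $R$), the auxiliary matrix $A$ by $$[A^{-1}]^l_m=\frac1{\binom nk f^{k-1}}\sum_{K\ni(m,l)}\left(\operatorname{adj}^m_l\left\|f\delta^i_j+\tfrac nk p^i_\alpha q^\alpha_j\right\|\right)_K\frac nk$$ (sum over $K\subset\{1,\dots,n\}$, $|K|=k$; $\operatorname{adj}$ is the cofactor in the submatrix with indices in $K$), $\gamma=\hat f^{\,k-2}/\det A$, and $q^*=p^tA^{-1}$,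 i.e. $(q^* )^\mu_m=[p^t]^\mu_l[A^{-1}]^l_m$. $A$ is nonsingular and this relation is resolved with respect to $q$; the Hamiltonian is $H=f^*(q^* )=\gamma(\tilde\Delta-f)$. The canonical system of Euler equations is $$\frac nk\frac{\partial[(q^* )^t]^m_\mu}{\partial t^m}=\frac{\partial H}{\partial x^\mu},\qquad \frac{\partial x^\mu}{\partial t^m}=-\frac{\partial H}{\partial[(q^* )^t]^m_\mu}.$$ Variational equations. Let $\eta^\sigma$ be parameters of the field of extremals (coordinates of the standard fiber of $\xi$), $U^m_{\mu\sigma}=\frac nk\frac{\partial[(q^* )^t]^m_\mu}{\partial\eta^\sigma}$, $V^\lambda_\sigma=\frac{\partial x^\lambda}{\partial\eta^\sigma}$. On a solution $\hat x(\cdot),\hat q^*(\cdot)$ (hats denote evaluation on it) the variational equations are $$\frac{\partial V}{\partial t^m}=-\hat H_{q^*x}V-\hat H_{q^*q^*}U,\qquad \frac{\partial U^m}{\partial t^m}=\hat H_{xx}V+\hat H_{xq^*}U.$$ Connection. With $W=UV^{-1}$, $\mathfrak Y^\alpha_{i\beta}=(H_{q^*q^*}U+H_{q^*x}V)V^{-1}=H_{q^*q^*}W+H_{q^*x}$. The connection $\nabla$ on $\xi$ has the form $\zeta^\alpha=dx^\alpha-\mathfrak Y^\alpha_{i\beta}x^\beta dt^i$ and covariant derivative $\nabla_{v^i}x^\alpha=v^i\frac{\partial x^\alpha}{\partial t^i}-v^i\mathfrak Y^\alpha_{i\beta}x^\beta$; horizontal vectors satisfy $dx-\mathfrak Y_ix\,dt^i=0$.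 The curvature form is the exterior covariant derivative $D\zeta$, i.e. the value of $d\zeta$ on horizontal components of vectors. A connection with zero curvature is called flat.
   Formalization: The sign of Y is corrected: Y_i = −(H_{q*q*}U + H_{q*x}V)V⁻¹, so that the columns of V are horizontal for dx − Y_i x dt^i; with the stated plus sign the connection is not flat when the matrices (∂V/∂t^i)V⁻¹ do not commute. *)

(* Defs.v *)
From HB Require Import structures.
From mathcomp Require Import all_boot all_order all_algebra.
From mathcomp Require Import all_classical all_reals all_analysis.

Set Implicit Arguments.
Unset Strict Implicit.
Unset Printing Implicit Defensive.

Import Order.TTheory GRing.Theory Num.Theory.
Import numFieldNormedType.Exports.

Local Open Scope classical_set_scope.
Local Open Scope ring_scope.

(* For V of finite dimension this is the usual class C^r on an open set. *)
Fixpoint classC (R : realType) (V W : normedModType R) (r : nat)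
    (D : set V) (g : V -> W) {struct r} : Prop :=
  match r with
  | 0 => forall z, D z -> {for z, continuous g}
  | r'.+1 => (forall z, D z -> differentiable g z) /\
             forall v, classC r' D (fun z => 'D_v g z)
  end.

Definition smooth (R : realType) (V W : normedModType R)
    (D : set V) (g : V -> W) : Prop := forall r, classC r D g.

(* Points (t, x, q), resp. (t, x, q^* ): base coordinates t in a row, fiber
   coordinates x in a column; row alpha, column i of the last component is
   q^alpha_i, resp. (q^* )^alpha_i. *)
Notation phase R n nu := ('rV[R]_n * 'cV[R]_nu * 'M[R]_(nu, n))%type.

Section Hamiltonian.
Context {R : realType} {n nu : nat}.
Implicit Types (f g : phase R n nu -> R) (z : phase R n nu).

Definition dt (i : 'I_n) : 'rV[R]_n := delta_mx 0 i.
Definition dx (mu : 'I_nu) : phase R n nu := (0, delta_mx mu 0, 0).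
Definition dq (al : 'I_nu) (i : 'I_n) : phase R n nu := (0, 0, delta_mx al i).

(* Row i, column alpha: p^i_alpha. *)
Definition momentum f z : 'M[R]_(n, nu) := \matrix_(i, al) 'D_(dq al i) f z.

(* || f delta^i_j + (n/k) p^i_alpha q^alpha_j || *)
Definition slopemx (k : nat) f z : 'M[R]_n :=
  (f z)%:M + (n%:R / k%:R) *: (momentum f z *m z.2).

Definition ksubset (k : nat) := {K : {set 'I_n} | #|K| == k}.

(* The a-th smallest element of K. *)
Definition kidx (k : nat) (K : ksubset k) (a : 'I_k) : 'I_n :=
  enum_val (cast_ord (esym (eqP (valP K))) a).

(* Lambda^k M, the matrix of all minors of order k. *)
Definition compound (k : nat) (M : 'M[R]_n) : 'M[R]_#|{: ksubset k}| :=
  \matrix_(a, b) \det (mxsub (kidx (enum_val a)) (kidx (enum_val b)) M).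

Definition Deltat (k : nat) f z : R :=
  \tr (compound k (slopemx k f z)) / ('C(n, k)%:R * f z ^+ (k - 1)).

(* Row l, column m of A^-1. The inner sum has a single term if m and l are in
   K and is empty otherwise; adj^m_l is the entry (m, l) of the adjugate, that
   is the cofactor of the element (l, m), so that p^t A^-1 is the derivative of
   Deltat with respect to q for fixed p and fixed value of f. *)
Definition Ainv (k : nat) f z : 'M[R]_n :=
  \matrix_(l, m)
    ((\sum_(K : ksubset k) \sum_(a | kidx K a == m) \sum_(b | kidx K b == l)
        (\adj (mxsub (kidx K) (kidx K) (slopemx k f z))) a b * (n%:R / k%:R))
     / ('C(n, k)%:R * f z ^+ (k - 1))).

Definition Amx (k : nat) f z : 'M[R]_n := invmx (Ainv k f z).

Definition gammaH (k : nat) f z : R := f z ^ (k%:Z - 2) / \det (Amx k f z).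

Definition qstar (k : nat) f z : 'M[R]_(nu, n) :=
  (momentum f z)^T *m Ainv k f z.

(* f is smooth and nonzero and A is nonsingular on D, and q^* = qstar (t, x, q)
   on D is solved by q = Q (t, x, q^* ) on Omega. *)
Record legendre (k : nat) (f : phase R n nu -> R) (D Omega : set (phase R n nu))
    (Q : phase R n nu -> 'M[R]_(nu, n)) : Prop := Legendre {
  legendre_open : open D /\ open Omega;
  legendre_smooth : smooth D f /\ smooth Omega Q;
  legendre_neq0 : forall z, D z -> f z != 0;
  legendre_nonsingular : forall z, D z -> Ainv k f z \in unitmx;
  legendre_resolved : forall t x q s,
    (D (t, x, q) /\ s = qstar k f (t, x, q)) <->
    (Omega (t, x, s) /\ q = Q (t, x, s))
}.

Definition hamiltonian (k : nat) f (Q : phase R n nu -> 'M[R]_(nu, n)) z : R :=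
  let y : phase R n nu := (z.1, Q z) in
  gammaH k f y * (Deltat k f y - f y).

(* On N, for a Hamiltonian H defined on Omega. *)
Record canonical_solution (k : nat) (H : phase R n nu -> R)
    (Omega : set (phase R n nu)) (N : set 'rV[R]_n)
    (x : 'rV[R]_n -> 'cV[R]_nu) (s : 'rV[R]_n -> 'M[R]_(nu, n)) : Prop :=
  CanonicalSolution {
  canonical_dom : forall t, N t -> Omega (t, x t, s t);
  canonical_C1 : classC 1 N x /\ classC 1 N s;
  canonical_q : forall t, N t -> forall mu,
    n%:R / k%:R * (\sum_(m < n) ('D_(dt m) s t) mu m)
    = 'D_(dx mu) H (t, x t, s t);
  canonical_x : forall t, N t -> forall m mu,
    ('D_(dt m) x t) mu 0 = - 'D_(dq mu m) H (t, x t, s t)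
}.

Definition Hxx (H : phase R n nu -> R) z : 'M[R]_nu :=
  \matrix_(mu, la) 'D_(dx la) ('D_(dx mu) H) z.
Definition Hqx (H : phase R n nu -> R) (m : 'I_n) z : 'M[R]_nu :=
  \matrix_(mu, la) 'D_(dx la) ('D_(dq mu m) H) z.
Definition Hxq (H : phase R n nu -> R) (l : 'I_n) z : 'M[R]_nu :=
  \matrix_(mu, la) 'D_(dq la l) ('D_(dx mu) H) z.
Definition Hqq (H : phase R n nu -> R) (m l : 'I_n) z : 'M[R]_nu :=
  \matrix_(mu, la) 'D_(dq la l) ('D_(dq mu m) H) z.

(* Along t |-> c t = (t, x t, q^* t); U m t has entries U^m_(mu sigma) and
   V t has entries V^lambda_sigma. V is C^2 as soon as it is C^1: the first
   equation expresses its derivatives through C^1 functions. *)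
Record variational_solution (H : phase R n nu -> R) (N : set 'rV[R]_n)
    (c : 'rV[R]_n -> phase R n nu)
    (U : 'I_n -> 'rV[R]_n -> 'M[R]_nu) (V : 'rV[R]_n -> 'M[R]_nu) : Prop :=
  VariationalSolution {
  variational_C1 : forall m, classC 1 N (U m);
  variational_C2 : classC 2 N V;
  variational_V : forall t, N t -> forall m,
    'D_(dt m) V t
    = - (Hqx H m (c t) *m V t) - \sum_(l < n) Hqq H m l (c t) *m U l t;
  variational_U : forall t, N t ->
    \sum_(m < n) 'D_(dt m) (U m) t
    = Hxx H (c t) *m V t + \sum_(l < n) Hxq H l (c t) *m U l t
}.

(* Y_i = -(H_(q^* q^* ) U + H_(q^* x) V) V^-1. With the sign conventions of
   the canonical system the minus sign is forced by the requirement that the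
   variations V of the field be horizontal for dx - Y_i x dt^i, i.e. that
   dV/dt^i = Y_i V. *)
Definition coefY (H : phase R n nu -> R) (c : 'rV[R]_n -> phase R n nu)
    (U : 'I_n -> 'rV[R]_n -> 'M[R]_nu) (V : 'rV[R]_n -> 'M[R]_nu)
    (i : 'I_n) (t : 'rV[R]_n) : 'M[R]_nu :=
  - ((\sum_(l < n) Hqq H i l (c t) *m U l t + Hqx H i (c t) *m V t)
     *m invmx (V t)).

End Hamiltonian.

(* The value at z of the exterior derivative of the 1-form w on a vector space
   E; a and b are extended to constant vector fields. *)
Definition ext_d (R : realType) (E W : normedModType R) (w : E -> E -> W)
    (z a b : E) : W :=
  'D_a (fun y => w y b) z - 'D_b (fun y => w y a) z.

Section Connection.
Context {R : realType} {n nu : nat}.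
Local Notation total := ('rV[R]_n * 'cV[R]_nu)%type.
Implicit Types (Y : 'I_n -> 'rV[R]_n -> 'M[R]_nu) (z a b : total).

(* zeta^alpha = dx^alpha - Y^alpha_(i beta) x^beta dt^i at z = (t, x), on a
   tangent vector a with components (a.1, a.2) along t and x. *)
Definition zeta Y z a : 'cV[R]_nu :=
  a.2 - \sum_(i < n) a.1 0 i *: (Y i z.1 *m z.2).

(* The vertical component of a is (0, zeta a). *)
Definition horizontal_part Y z a : total := (a.1, a.2 - zeta Y z a).

Definition curvature Y z a b : 'cV[R]_nu :=
  ext_d (zeta Y) z (horizontal_part Y z a) (horizontal_part Y z b).

Definition flat_on Y (N : set 'rV[R]_n) : Prop :=
  forall t x a b, N t -> curvature Y (t, x) a b = 0.

End Connection.

(* Main.v *)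
(* The first variational equation says that dV/dt^i = Y_i V, so that Y is the
   logarithmic derivative (dV) V^-1 and the columns of V are parallel sections
   spanning the fiber. Along horizontal lifts the derivative of (dV) V^-1
   cancels the connection terms, and the value of the curvature form on (a, b)
   is ('D_b ('D_a V) - 'D_a ('D_b V)) V^-1 x, which vanishes by the symmetry of
   second derivatives. *)
Require Import Defs.
From mathcomp Require Import all_boot all_order all_algebra.
From mathcomp Require Import perm.
From mathcomp Require Import all_classical all_reals all_analysis.

Import Order.TTheory GRing.Theory Num.Theory.
Import numFieldNormedType.Exports.

Set Implicit Arguments.
Unset Strict Implicit.
Unset Printing Implicit Defensive.

Local Open Scope classical_set_scope.
Local Open Scope ring_scope.

(** * Symmetry of second directional derivatives of real functions *)

(** The two difference quotients coincide, so directional derivability suffices and no chain rule is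
    invoked. *)
Lemma is_derive_line (R : realType) (E F : normedModType R) (g : E -> F)
    (p a : E) (s : R) :
  derivable g (s *: a + p) a ->
  is_derive s 1 (fun r => g (r *: a + p)) ('D_a g (s *: a + p)).
Proof.
have q : (fun h : R => h^-1 *: (((fun r => g (r *: a + p)) \o shift s) (h *: 1)
                              - g (s *: a + p)))
         = (fun h : R => h^-1 *: ((g \o shift (s *: a + p)) (h *: a)
                                - g (s *: a + p))).
  by apply/funext => h /=; rewrite [h *: 1]mulr1 scalerDl addrA.
by move=> dg; apply: DeriveDef; rewrite /derivable /derive q.
Qed.

(** The one-dimensional mean value theorem is applied twice, first along [a], then along [b]. *)
Lemma second_difference_MVT (R : realType) (E : normedModType R) (g : E -> R)
    (t a b : E) (h : R) (h0 : 0 < h) :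
  (forall s r, s \in `[0, h] -> r \in `[0, h] ->
    derivable g (s *: a + (r *: b + t)) a /\
    derivable ('D_a g) (s *: a + (r *: b + t)) b) ->
  exists s r, [/\ s \in `[0, h], r \in `[0, h] &
    g (h *: a + (h *: b + t)) - g (h *: a + t) - (g (h *: b + t) - g t)
    = 'D_b ('D_a g) (s *: a + (r *: b + t)) * h * h].
Proof.
move=> dg.
have i0 : 0 \in `[0, h] by rewrite in_itv /= lexx ltW.
have ih : h \in `[0, h] by rewrite in_itv /= lexx ltW.
have sub c : c \in `]0, h[ -> c \in `[0, h].
  by rewrite !in_itv /= => /andP[/ltW -> /ltW ->].
(* The second difference is the increment of [F] over [[0, h]]. *)
pose F s := g (s *: a + (h *: b + t)) - g (s *: a + t).
pose dF s := 'D_a g (s *: a + (h *: b + t)) - 'D_a g (s *: a + t).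
have FP s : s \in `[0, h] -> is_derive s 1 F (dF s).
  move=> sh; have [d1 _] := dg s h sh ih; have [d2 _] := dg s 0 sh i0.
  rewrite scale0r add0r in d2.
  exact: is_deriveB (is_derive_line d1) (is_derive_line d2).
have Fc : {within `[0, h], continuous F}.
  by apply: derivable_within_continuous => s sh; have [] := FP s sh.
have [s sh Fs] := MVT h0 (fun s sh => FP s (sub s sh)) Fc.
(* With [s] fixed, [dF s] is the increment of [G] over [[0, h]]. *)
pose G r := 'D_a g (r *: b + (s *: a + t)).
pose dG r := 'D_b ('D_a g) (r *: b + (s *: a + t)).
have GP r : r \in `[0, h] -> is_derive r 1 G (dG r).
  move=> rh; have [_ d] := dg s r (sub s sh) rh; rewrite addrCA in d.
  exact: is_derive_line d.
have Gc : {within `[0, h], continuous G}.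
  by apply: derivable_within_continuous => r rh; have [] := GP r rh.
have [r rh Gr] := MVT h0 (fun r rh => GP r (sub r rh)) Gc.
exists s, r; split; [exact: sub|exact: sub|].
move: Fs Gr; rewrite /F /G /dF /dG !subr0 !scale0r !add0r => ->.
by rewrite (addrCA (h *: b)) => ->; rewrite (addrCA (r *: b)).
Qed.

(** Both mixed derivatives, taken at suitable points near [t], equal the same second difference
    divided by [h ^+ 2]; continuity at [t] brings the two values together. *)
Lemma derive_commute (R : realType) (E : normedModType R) (g : E -> R)
    (t a b : E) :
  (\forall y \near t, [/\ derivable g y a, derivable g y b,
     derivable ('D_a g) y b & derivable ('D_b g) y a]) ->
  {for t, continuous ('D_b ('D_a g))} -> {for t, continuous ('D_a ('D_b g))} ->
  'D_b ('D_a g) t = 'D_a ('D_b g) t.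
Proof.
move=> dg /cvgrPdist_lt cab /cvgrPdist_lt cba.
apply/eqP; rewrite -subr_eq0 -normr_le0; apply/ler_addgt0Pl => e e0.
rewrite addr0.
have e20 : 0 < e / 2 by rewrite divr_gt0.
have : \forall y \near t, [/\ [/\ derivable g y a, derivable g y b,
     derivable ('D_a g) y b & derivable ('D_b g) y a],
     `|'D_b ('D_a g) t - 'D_b ('D_a g) y| < e / 2 &
     `|'D_a ('D_b g) t - 'D_a ('D_b g) y| < e / 2].
  apply: filterS3 dg (cab _ e20) (cba _ e20) => y d1 d2 d3.
  exact: And3 d1 d2 d3.
move=> /nbhs_ballP[r /= r0 rP].
(* With this [h] the parallelogram at [t] spanned by [h *: a] and [h *: b] lies in the ball of
   radius [r]; the summand 1 keeps [M] positive when [a] and [b] vanish. *)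
pose M := `|a| + `|b| + 1.
have M0 : 0 < M by rewrite ltr_wpDl // addr_ge0.
pose h := r / 2 / M.
have h0 : 0 < h by rewrite !divr_gt0.
have near_t s u : s \in `[0, h] -> u \in `[0, h] ->
    ball t r (s *: a + (u *: b + t)).
  rewrite !in_itv /= => /andP[s0 sh] /andP[u0 uh].
  rewrite -ball_normE /= addrA opprD addrCA subrr addr0 normrN.
  rewrite (le_lt_trans (ler_normD _ _)) // !normrZ !ger0_norm //.
  have : s * `|a| + u * `|b| <= h * M.
    rewrite !mulrDr mulr1; apply: ler_wpDr; first exact: ltW.
    by apply: lerD; apply: ler_wpM2r.
  move=> /le_lt_trans; apply; rewrite divfK ?gt_eqF //.
  by rewrite ltr_pdivrMr // ltr_pMr // ltr1n.
have [s [u [sh uh Esu]]] : exists s u, [/\ s \in `[0, h], u \in `[0, h] &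
    g (h *: a + (h *: b + t)) - g (h *: a + t) - (g (h *: b + t) - g t)
    = 'D_b ('D_a g) (s *: a + (u *: b + t)) * h * h].
  apply: second_difference_MVT h0 _ => s u sh uh.
  have [[d1 _ d2 _] _ _] := rP _ (near_t s u sh uh).
  by split; [exact: d1|exact: d2].
have [s' [u' [sh' uh' Esu']]] : exists s u, [/\ s \in `[0, h], u \in `[0, h] &
    g (h *: b + (h *: a + t)) - g (h *: b + t) - (g (h *: a + t) - g t)
    = 'D_a ('D_b g) (s *: b + (u *: a + t)) * h * h].
  apply: second_difference_MVT h0 _ => s' u' sh' uh'.
  have := near_t u' s' uh' sh'; rewrite addrCA => /rP[[_ d1 _ d2] _ _].
  by split; [exact: d1|exact: d2].
have [_ Hab _] := rP _ (near_t s u sh uh).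
have := near_t u' s' uh' sh'; rewrite addrCA => /rP[_ _ Hba].
have hn0 : h != 0 by rewrite gt_eqF.
have eqXY (P X Y : R) : P = X * h * h -> P = Y * h * h -> X = Y.
  by move=> -> /(mulIf hn0)/(mulIf hn0).
(* Exchanging [a] and [b] only permutes the middle terms of the second difference. *)
have swap (P X Y Z : R) : P - X - (Y - Z) = P - Y - (X - Z).
  by rewrite !opprB !addrA ![_ + Z - _]addrAC (addrAC P).
rewrite (addrCA (h *: b)) swap in Esu'.
have E12 := eqXY _ _ _ Esu Esu'.
rewrite E12 in Hab; rewrite distrC in Hba.
(* The common intermediate value is within [e / 2] of each mixed derivative at [t]. *)
rewrite (splitr e); apply: le_trans (ltW (ltrD Hab Hba)); exact: ler_distD.
Qed.

(** * Derivatives of matrix products, determinants and inverses *)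

Lemma is_derive_mulmx (R : realFieldType) (E : normedModType R) (m p q : nat)
    (A : E -> 'M[R]_(m, p)) (B : E -> 'M[R]_(p, q)) (z v : E) dA dB :
  is_derive z v A dA -> is_derive z v B dB ->
  is_derive z v (fun y => A y *m B y) (dA *m B z + A z *m dB).
Proof.
move=> [dAz <-] [dBz <-].
have dAij := (derivable_mxP A z v).1 dAz.
have dBij := (derivable_mxP B z v).1 dBz.
have dABij i j : is_derive z v (fun y => (A y *m B y) i j)
   (\sum_k (A z i k *: 'D_v (fun y => B y k j) z
            + B z k j *: 'D_v (fun y => A y i k) z)).
  have -> : (fun y => (A y *m B y) i j)
            = \sum_k ((fun y => A y i k) * (fun y => B y k j)).
    by apply/funext => y; rewrite mxE fct_sumE.
  apply: is_derive_sum => k; apply: is_deriveM; apply: derivableP.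
    exact: dAij.
  exact: dBij.
have dAB : derivable (fun y => A y *m B y) z v.
  by apply/derivable_mxP => i j; have [] := dABij i j.
apply: DeriveDef => //; rewrite derive_mx //; apply/matrixP => i j.
rewrite mxE; have [_ ->] := dABij i j; rewrite !mxE -big_split /=.
apply: eq_bigr => k _.
by rewrite (derive_mx dAz) (derive_mx dBz) !mxE [RHS]addrC /GRing.scale /= [B z k j * _]mulrC.
Qed.

Lemma derivable_prod (R : realFieldType) (E : normedModType R) (I : Type)
    (r : seq I) (g : I -> E -> R) (z v : E) :
  (forall i, derivable (g i) z v) ->
  derivable (fun y => \prod_(i <- r) g i y) z v.
Proof.
move=> dg; elim: r => [|i r IH].
  by under eq_fun do rewrite big_nil; exact: derivable_cst.
under eq_fun do rewrite big_cons.
by apply: (derivableM (f := g i)); [exact: dg|exact: IH].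
Qed.

(** By the expansion over permutations the determinant is a polynomial in the entries. *)
Lemma derivable_det (R : realFieldType) (E : normedModType R) (m : nat)
    (A : E -> 'M[R]_m) (z v : E) :
  derivable A z v -> derivable (fun y => \det (A y)) z v.
Proof.
move=> /derivable_mxP dA.
have -> : (fun y => \det (A y)) =
    \sum_(s : {perm 'I_m}) (fun y => (-1) ^+ s * \prod_i A y i (s i)).
  by apply/funext => y; rewrite fct_sumE.
elim/big_ind: _ => [|f g df dg|s _].
- exact: derivable_cst.
- by apply: derivableD; [exact: df|exact: dg].
apply: (derivableM (f := fun=> _)); first exact: derivable_cst.
by apply: derivable_prod => i; exact: dA.
Qed.

(** Cramer's formula describes [invmx] at invertible matrices only; elsewhere [invmx] returns its
    argument. Hence invertibility is asked on a neighbourhood. *)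
Lemma derivable_invmx (R : realFieldType) (E : normedModType R) (m : nat)
    (A : E -> 'M[R]_m) (z v : E) :
  (\forall y \near z, A y \in unitmx) ->
  derivable A z v -> derivable (fun y => invmx (A y)) z v.
Proof.
move=> uA dA; apply: (@near_eq_derivable _ _ _
    (fun y => (\det (A y))^-1 *: \adj (A y))).
  by apply: filterS uA => y uAy; rewrite /invmx uAy.
apply/derivable_mxP => i j.
have -> : (fun y => ((\det (A y))^-1 *: \adj (A y)) i j)
   = (fun y => (\det (A y))^-1)
     * (fun y => (-1) ^+ (j + i) * \det (row' j (col' i (A y)))).
  by apply/funext => y; rewrite !mxE.
apply: derivableM.
  apply: derivableV; last exact: derivable_det.
  by have := nbhs_singleton uA; rewrite unitmxE unitfE.
apply: (derivableM (f := fun=> _)); first exact: derivable_cst.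
apply: derivable_det; apply/derivable_mxP => i' j'.
under eq_fun do rewrite !mxE.
exact: ((derivable_mxP A z v).1 dA).
Qed.

(** Once derivability is known, the value follows by differentiating the locally constant product of
    the inverse with [A]. *)
Lemma is_derive_invmx (R : realFieldType) (E : normedModType R) (m : nat)
    (A : E -> 'M[R]_m) (z v : E) dA :
  (\forall y \near z, A y \in unitmx) -> is_derive z v A dA ->
  is_derive z v (fun y => invmx (A y)) (- (invmx (A z) *m dA *m invmx (A z))).
Proof.
move=> uA dAz; have uAz := nbhs_singleton uA.
have dI := derivableP (derivable_invmx uA (@ex_derive _ _ _ _ _ _ _ dAz)).
have d1 := is_derive_mulmx dI dAz.
have d0 : 'D_v (fun y => invmx (A y) *m A y) z = 0.
  rewrite -(derive_cst (1%:M : 'M[R]_m) z v); apply: near_eq_derive.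
  by apply: filterS uA => y; exact: mulVmx.
apply: (is_derive_eq dI); apply: (can_inj (mulmxK uAz)).
apply/eqP; rewrite mulNmx -addr_eq0 -!mulmxA mulVmx // mulmx1.
by apply/eqP; move: d0; rewrite (@derive_val _ _ _ _ _ _ _ d1).
Qed.

(** * Projections of a product, matrix entries, and symmetry for matrix functions *)

(** Operations on pairs are componentwise, so the difference quotients agree by computation. *)
Lemma is_derive_fst (R : realType) (E F G : normedModType R) (g : E -> G)
    (z a : E * F) dg :
  is_derive z.1 a.1 g dg -> is_derive z a (fun y : E * F => g y.1) dg.
Proof. by move=> [d e]; apply: DeriveDef; [exact: d|exact: e]. Qed.

Lemma is_derive_snd (R : realType) (E F G : normedModType R) (g : F -> G)
    (z a : E * F) dg :
  is_derive z.2 a.2 g dg -> is_derive z a (fun y : E * F => g y.2) dg.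
Proof. by move=> [d e]; apply: DeriveDef; [exact: d|exact: e]. Qed.

Lemma derive_mx_entry (R : realFieldType) (E : normedModType R) (m n : nat)
    (M : E -> 'M[R]_(m, n)) (t v : E) i j :
  derivable M t v -> 'D_v (fun y => M y i j) t = ('D_v M t) i j.
Proof. by move=> dM; rewrite (derive_mx dM) mxE. Qed.

Lemma continuous_entry (R : realFieldType) (E : normedModType R) (m n : nat)
    (M : E -> 'M[R]_(m, n)) (t : E) i j :
  {for t, continuous M} -> {for t, continuous (fun y => M y i j)}.
Proof.
move=> cM; apply: (@continuous_comp _ _ _ M (fun B : 'M[R]_(m, n) => B i j)).
  exact: cM.
exact: coord_continuous.
Qed.

(** The scalar case is applied to each entry. Taking entries commutes with derivatives at points of
    [D]; openness lets these identities be differentiated again. *)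
Lemma derive_mx_commute (R : realType) (E : normedModType R) (m n : nat)
    (D : set E) (M : E -> 'M[R]_(m, n)) (t a b : E) :
  open D -> D t -> classC 2 D M -> 'D_b ('D_a M) t = 'D_a ('D_b M) t.
Proof.
move=> oD Dt [dM C1].
have nD : \forall y \near t, D y by exact: open_nbhs_nbhs.
have dMv y v : D y -> derivable M y v by move=> /dM; exact: diff_derivable.
have d2M y v w : D y -> derivable ('D_v M) y w.
  by move=> Dy; have [d _] := C1 v; exact/diff_derivable/d.
apply/matrixP => i j.
pose g y := M y i j.
have Dg y v : D y -> 'D_v g y = ('D_v M y) i j.
  by move=> Dy; apply: derive_mx_entry; exact: dMv.
have D2g y v w : D y -> 'D_w ('D_v g) y = ('D_w ('D_v M) y) i j.
  move=> Dy; rewrite -(derive_mx_entry i j (d2M y v w Dy)).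
  apply: near_eq_derive.
  have : \forall x \near y, D x by exact: open_nbhs_nbhs.
  by apply: filterS => x; exact: Dg.
have dg y v : D y -> derivable g y v.
  by move=> Dy; exact: ((derivable_mxP M y v).1 (dMv y v Dy)).
have d2g y v w : D y -> derivable ('D_v g) y w.
  move=> Dy; apply: (@near_eq_derivable _ _ _ (fun x => ('D_v M x) i j)).
    have : \forall x \near y, D x by exact: open_nbhs_nbhs.
    by apply: filterS => x Dx; rewrite Dg.
  exact: ((derivable_mxP ('D_v M) y w).1 (d2M y v w Dy)).
have c2g v w : {for t, continuous ('D_w ('D_v g))}.
  have cM : {for t, continuous ('D_w ('D_v M))}.
    by have [_ c] := C1 v; exact: c w t Dt.
  have := continuous_entry (i := i) (j := j) cM.
  rewrite /prop_for /continuous_at D2g //; apply: cvg_trans.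
  apply: near_eq_cvg; by apply: filterS nD => x Dx; rewrite D2g.
have dg4 : \forall y \near t, [/\ derivable g y a, derivable g y b,
    derivable ('D_a g) y b & derivable ('D_b g) y a].
  apply: filterS nD => y Dy.
  exact: And4 (dg _ _ Dy) (dg _ _ Dy) (d2g _ _ _ Dy) (d2g _ _ _ Dy).
have e := derive_commute dg4 (c2g a b) (c2g b a).
exact: etrans (esym (D2g t a b Dt)) (etrans e (D2g t b a Dt)).
Qed.

(** * Flatness of the connection *)

(** Such a [Y] is a gauge transform of the trivial connection, with [V] as parallel frame; the
    Hamiltonian does not appear. *)
Lemma flat_on_logarithmic_derivative (R : realType) (n nu : nat)
    (N : set 'rV[R]_n) (V : 'rV[R]_n -> 'M[R]_nu)
    (Y : 'I_n -> 'rV[R]_n -> 'M[R]_nu) :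
  open N -> classC 2 N V -> (forall t, N t -> V t \in unitmx) ->
  (forall t i, N t -> Y i t = 'D_(dt i) V t *m invmx (V t)) ->
  flat_on Y N.
Proof.
move=> oN C2 uV YE t x a b Nt; have [dV C1] := C2.
have dVv y v : N y -> derivable V y v by move=> /dV; exact: diff_derivable.
have d2V y v w : N y -> derivable ('D_v V) y w.
  by move=> Ny; have [d _] := C1 v; exact/diff_derivable/d.
(* [P v] is the contraction of [Y] with [v]; linearity of the differential extends the hypothesis
   from the basis directions [dt i] to every [v]. *)
pose P v y := 'D_v V y *m invmx (V y).
have sumY (v : 'rV[R]_n) y : N y -> \sum_i v 0 i *: Y i y = P v y.
  move=> Ny; rewrite /P (deriveE v (dV y Ny)) [in RHS](row_sum_delta v).
  rewrite linear_sum mulmx_suml; apply: eq_bigr => i _.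
  by rewrite linearZ -scalemxAl YE // deriveE //; exact: dV.
have zetaE y u : N y.1 -> zeta Y y u = u.2 - P u.1 y.1 *m y.2.
  move=> Ny; rewrite /zeta; congr (_ - _); rewrite -sumY // mulmx_suml.
  by apply: eq_bigr => i _; rewrite scalemxAl.
(* This is the horizontal lift of [v] at [(t, x)]. As [y] varies below it stays a constant vector,
   as [ext_d] requires. *)
pose horiz (v : 'rV[R]_n) : 'rV[R]_n * 'cV[R]_nu := (v, P v t *m x).
have horE u : horizontal_part Y (t, x) u = horiz u.1.
  by rewrite /horizontal_part zetaE // opprB addrCA subrr addr0.
(* Folding K fixes one ring structure on 'M[R]_nu: the unfolded products would
   be compared through distinct instances, which does not terminate in
   practice. *)
pose K (M : 'M[R]_nu) := - (M *m invmx (V t) *m x).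
have dzeta u v : 'D_(horiz u) (fun y => zeta Y y (horiz v)) (t, x)
    = K ('D_u ('D_v V) t).
  have nN : \forall y \near t, N y by exact: open_nbhs_nbhs.
  (* The formula for [zeta] holds over [N] only; it may be differentiated because it holds near
     [(t, x)] in the total space. *)
  have nN2 : \forall y \near (t, x), N (y : 'rV[R]_n * 'cV[R]_nu).1.
    exact: (@cvg_fst _ _ _ _ _ _ nN).
  have -> : 'D_(horiz u) (fun y => zeta Y y (horiz v)) (t, x)
     = 'D_(horiz u) (fun y => P v t *m x - P v y.1 *m y.2) (t, x).
    by apply: near_eq_derive; apply: filterS nN2 => y Ny; rewrite zetaE.
  have uVn : \forall y \near t, V y \in unitmx.
    by apply: filterS nN => y; exact: uV.
  have dP := is_derive_mulmx (derivableP (d2V t v u Nt))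
    (is_derive_invmx uVn (derivableP (dVv t u Nt))).
  have dPf := is_derive_fst (z := (t, x)) (a := horiz u) dP.
  have dx2 := is_derive_snd (z := (t, x)) (a := horiz u)
    (is_derive_id x (P u t *m x)).
  have d := is_deriveB (is_derive_cst (P v t *m x) (t, x) (horiz u))
    (is_derive_mulmx dPf dx2).
  rewrite (@derive_val _ _ _ _ _ _ _ d) sub0r /=; congr (- _).
  (* Here [A] is the second derivative of [V], [B] and [C] are its derivatives along [v] and [u],
     and [I] is its inverse. The term from differentiating the inverse cancels against the motion of
     the fiber point along the lift of [u]. *)
  have cancel (A B C I : 'M[R]_nu) :
      (A *m I + B *m - (I *m C *m I)) *m x + B *m I *m (C *m I *m x)
      = A *m I *m x.
    by rewrite mulmxDl mulmxN mulNmx !mulmxA -addrA addNr addr0.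
  exact: cancel.
rewrite /curvature !horE.
apply: etrans (congr2 (fun p q => p - q) (dzeta a.1 b.1) (dzeta b.1 a.1)) _.
have e := derive_mx_commute a.1 b.1 oN Nt C2.
apply/eqP; rewrite subr_eq0; apply/eqP.
exact (congr1 K (esym e)).
Qed.

Theorem theorem10 (R : realType) (n nu k : nat) (hk : (1 <= k <= n)%N)
    (f : phase R n nu -> R) (D Omega : set (phase R n nu))
    (Q : phase R n nu -> 'M[R]_(nu, n)) (hQ : legendre k f D Omega Q)
    (N : set 'rV[R]_n) (hN : open N) (hNc : connected N) (hN0 : N !=set0)
    (xhat : 'rV[R]_n -> 'cV[R]_nu) (qhat : 'rV[R]_n -> 'M[R]_(nu, n))
    (hext : canonical_solution k (hamiltonian k f Q) Omega N xhat qhat)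
    (U : 'I_n -> 'rV[R]_n -> 'M[R]_nu) (V : 'rV[R]_n -> 'M[R]_nu)
    (hUV : variational_solution (hamiltonian k f Q) N
             (fun t => (t, xhat t, qhat t)) U V)
    (hV : forall t, N t -> V t \in unitmx) :
  flat_on (coefY (hamiltonian k f Q) (fun t => (t, xhat t, qhat t)) U V) N.
Proof.
apply: flat_on_logarithmic_derivative hN (variational_C2 hUV) hV _ => t i Nt.
(* The first variational equation gives [dV/dt^i] as minus the bracket in [coefY]; the factor
   [invmx (V t)] is common to both sides. *)
rewrite (variational_V hUV) // /coefY -mulNmx; congr (_ *m _).
by rewrite opprD addrC.
Qed.
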